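(* Let $n\geq 2$, let $f:\mathbb{R}^n\to\mathbb{R}$ be defined by $f(x_1,\dots,x_n)=|x_1|$, and let $\varepsilon:\mathbb{R}^n\to(0,\infty)$ be continuous with $\lim_{|x|\to\infty}\varepsilon(x)=0$. Then there is no $C^1$ convex function $g:\mathbb{R}^n\to\mathbb{R}$ such that $|f(x)-g(x)|\leq\varepsilon(x)$ for all $x\in\mathbb{R}^n$.
   Context: All notions are standard. *)

(* Defs.v *)
From HB Require Import structures.
From mathcomp Require Import all_boot all_order all_algebra.
From mathcomp Require Import all_classical all_reals all_analysis.

Set Implicit Arguments.
Unset Strict Implicit.
Unset Printing Implicit Defensive.

Import Order.TTheory GRing.Theory Num.Theory.
Import numFieldNormedType.Exports.

Local Open Scope classical_set_scope.
Local Open Scope ring_scope.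

(* The library norm `|x| on 'rV[R]_n is the sup norm. *)
Definition enorm (R : realType) (n : nat) (x : 'rV[R]_n) : R :=
  Num.sqrt (\sum_(i < n) x ord0 i ^+ 2).

(* The filter of neighbourhoods of infinity: F @ enorm_infty --> l reads
   "F(x) tends to l as |x| tends to infinity". *)
Definition enorm_infty (R : realType) (n : nat) : set_system 'rV[R]_n :=
  filter_from [set: R] (fun M => [set x | M < enorm x]).
Arguments enorm_infty : clear implicits.

#[global] Instance enorm_infty_filter (R : realType) (n : nat) :
  Filter (enorm_infty R n).
Proof.
apply: filter_from_filter; first by exists 0.
move=> M N _ _; exists (Num.max M N) => // x /=.
by rewrite gt_max => /andP[? ?]; split.
Qed.

(* C^1 on R^n: all first-order partial derivatives exist and are continuous. *)
Definition C1 (R : realType) (n : nat) (g : 'rV[R]_n -> R) : Prop :=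
  forall i : 'I_n,
    (forall x, derivable g x (delta_mx ord0 i)) /\
    continuous (fun x => 'D_(delta_mx ord0 i) g x).

(* Main.v *)
Require Import Defs.
From HB Require Import structures.
From mathcomp Require Import all_boot all_order all_algebra.
From mathcomp Require Import all_classical all_reals all_analysis.
From mathcomp Require Import ring lra.

Set Implicit Arguments.
Unset Strict Implicit.
Unset Printing Implicit Defensive.

Import Order.TTheory GRing.Theory Num.Theory.
Import numFieldNormedType.Exports.

Local Open Scope classical_set_scope.
Local Open Scope ring_scope.

(* On a line {x + t e_2} the function |x_1| is constant, so g restricted to it
   is convex and tends to |x_1| at both ends. Such a function is constant, hence
   g = |x_1| everywhere, and this is not differentiable at 0 along e_1. *)

Lemma ler_coord_enorm (R : realType) (n : nat) (x : 'rV[R]_n) (i : 'I_n) :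
  `|x ord0 i| <= enorm x.
Proof.
rewrite -sqrtr_sqr ler_sqrt; last by apply: sumr_ge0 => j _; exact: sqr_ge0.
by rewrite (bigD1 i) //= lerDl; apply: sumr_ge0 => j _; exact: sqr_ge0.
Qed.

Lemma convex_function_midpoint (R : realType) (E : lmodType R) (g : E -> R)
    (x y : E) :
  convex_function [set: E] g -> g (2^-1 *: (x + y)) <= (g x + g y) / 2.
Proof.
have h0 : (0 : R) <= 2^-1 by rewrite invr_ge0 ler0n.
have h1 : (2^-1 : R) <= 1 by rewrite invf_le1 ?ler1n ?ltr0n.
move=> gconv.
have : g (2^-1 *: x + (1 - 2^-1) *: y) <= 2^-1 * g x + (1 - 2^-1) * g y.
  by apply: (gconv (Itv01 h0 h1)); rewrite in_setT.
have -> : 1 - 2^-1 = 2^-1 :> R by field.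
by rewrite -scalerDr -mulrDr mulrC.
Qed.

(** Two midpoints pin down [h 0] for large [t]: 0 is the midpoint of [t] and [- t], which gives
    [h 0 <= (h t + h (- t)) / 2], close to [l]; and [t] is the midpoint of 0 and [2 * t], which
    gives [h 0 >= 2 * h t - h (2 * t)], again close to [l]. *)
Lemma midpoint_convex_eq_limit (R : realType) (h : R -> R) (l : R) :
  (forall s t, h ((s + t) / 2) <= (h s + h t) / 2) ->
  (forall e, 0 < e -> exists M, forall t, M < `|t| -> `|h t - l| < e) ->
  h 0 = l.
Proof.
move=> hmid hlim; apply/eqP; rewrite -subr_eq0 -normr_le0.
apply/ler_addgt0Pl => e e0.
(* The lower bound [2 * h t - h (2 * t)] adds up three errors, hence the third of [e]. *)
have e3 : 0 < e / 3 by lra.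
have [M hM] := hlim _ e3.
(* [M] may be negative; this [t] is positive and exceeds [M], and so does [2 * t]. *)
pose t := `|M| + 1.
have M_t : M < t by have := ler_norm M; rewrite /t; lra.
have t0 : 0 < t by have := normr_ge0 M; rewrite /t; lra.
have h1 : `|h t - l| < e / 3 by apply: hM; rewrite gtr0_norm.
have h2 : `|h (- t) - l| < e / 3 by apply: hM; rewrite normrN gtr0_norm.
have h3 : `|h (2 * t) - l| < e / 3 by apply: hM; rewrite gtr0_norm; lra.
have := hmid t (- t); have := hmid 0 (2 * t).
have -> : (0 + 2 * t) / 2 = t by field.
have -> : (t + - t) / 2 = 0 by field.
move: h1 h2 h3; rewrite !ltr_norml addr0 ler_norml.
move=> /andP[? ?] /andP[? ?] /andP[? ?] ? ?.
by apply/andP; split; lra.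
Qed.

(** The difference quotients at [a] along [v] are 1 for positive and -1 for negative steps, and no
    [L] lies at distance less than 1 from both. *)
Lemma abs_on_line_not_derivable (R : realType) (V : normedModType R)
    (g : V -> R) (a v : V) :
  (forall t : R, g (t *: v + a) = `|t|) -> ~ derivable g a v.
Proof.
move=> gE /cvg_ex[/= L /cvgrPdist_lt /(_ 1 ltr01)].
have ga : g a = 0 by have := gE 0; rewrite scale0r add0r normr0.
rewrite /dnbhs /within /= => /nbhs_ballP[e /= e0 he].
have quot (s : R) : `|s| < e -> s != 0 -> `|L - s^-1 * `|s| | < 1.
  move=> se s0; have := he s; rewrite /ball /= sub0r normrN => /(_ se s0).
  by rewrite gE ga subr0.
have e2 : 0 < e / 2 by rewrite divr_gt0.
have lt_e2 : e / 2 < e by lra.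
have := quot (e / 2); have := quot (- (e / 2)).
rewrite oppr_eq0 normrN (gtr0_norm e2) (gt_eqF e2) => /(_ lt_e2 isT) + /(_ lt_e2 isT).
rewrite invrN mulNr mulVf ?gt_eqF // !ltr_norml.
by move=> /andP[? ?] /andP[? ?]; lra.
Qed.

Lemma convex_approx_coord_eq (R : realType) (n : nat) (i j : 'I_n)
    (eps g : 'rV[R]_n -> R) :
  i != j ->
  eps x @[x --> enorm_infty R n] --> (0 : R) ->
  convex_function [set: 'rV[R]_n] g ->
  (forall x : 'rV[R]_n, `| `|x ord0 i| - g x| <= eps x) ->
  forall x : 'rV[R]_n, g x = `|x ord0 i|.
Proof.
move=> ij /cvgr0Pnorm_lt eps_lim gconv approx x.
pose ej : 'rV[R]_n := delta_mx ord0 j.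
have coordj t : (x + t *: ej) ord0 j = x ord0 j + t.
  by rewrite !mxE !eqxx mulr1.
have coordi t : (x + t *: ej) ord0 i = x ord0 i.
  by rewrite !mxE (negbTE ij) andbF mulr0 addr0.
(* The line in direction [ej] is based at [x] itself, so [g x] is the value at parameter 0. *)
rewrite -[in LHS](addr0 x) -(scale0r ej).
apply: (@midpoint_convex_eq_limit _ (fun t => g (x + t *: ej))) => [s t|e e0].
  rewrite (_ : x + _ = 2^-1 *: ((x + s *: ej) + (x + t *: ej))).
    exact: convex_function_midpoint.
  by apply/rowP => k; rewrite !mxE; field.
have [M _ hM] := eps_lim e e0.
(* The norm of [x + t *: ej] is at least its [j]-th coordinate in absolute value, hence at least
   [|t| - |x_j|]. *)
exists (M + `|x ord0 j|) => t Mt.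
have /hM : M < enorm (x + t *: ej).
  apply: lt_le_trans (ler_coord_enorm _ j); rewrite coordj.
  have := lerB_normD t (x ord0 j); rewrite [t + _]addrC; lra.
move=> /(le_lt_trans (ler_norm _)); apply: le_lt_trans.
by rewrite distrC; have := approx (x + t *: ej); rewrite coordi.
Qed.

Theorem mainTheorem7 (R : realType) (n : nat) (hn : (2 <= n)%N)
    (f : 'rV[R]_n -> R)
    (hf : forall x : 'rV[R]_n, f x = `|x ord0 (Ordinal (ltnW hn))|)
    (eps : 'rV[R]_n -> R)
    (eps_gt0 : forall x : 'rV[R]_n, 0 < eps x)
    (eps_cont : continuous eps)
    (eps_lim : eps x @[x --> enorm_infty R n] --> (0 : R)) :
  ~ exists g : 'rV[R]_n -> R,
      [/\ C1 g,
          convex_function [set: 'rV[R]_n] g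
        & forall x : 'rV[R]_n, `|f x - g x| <= eps x].
Proof.
case=> g [gC1 gconv approx].
set i0 := Ordinal (ltnW hn) in hf.
have gE : forall x : 'rV[R]_n, g x = `|x ord0 i0|.
  (* Indices start at 0: [hn] reads as [1 < n], so [Ordinal hn] is the second coordinate. *)
  apply: (@convex_approx_coord_eq _ _ i0 (Ordinal hn)) eps_lim gconv _ => //.
  by move=> x; rewrite -hf.
(* The contradiction is at the origin, where [g] is [|t|] along the first axis. *)
have [/(_ 0) + _] := gC1 i0.
by apply: abs_on_line_not_derivable => t; rewrite gE !mxE !eqxx mulr1 addr0.
Qed.
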